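(* Let $b\ge2$ be an integer, let $G=\bigoplus_{i\in\mathbb{N}}\mathbb{Z}_b$, and for real $\alpha\in(b,\infty)$ let $\mu_\alpha(y)=\alpha^{-\ell(y)}$ for $y\in G$. Then the percolation model $G_{\mu_\alpha}(\lambda)$ satisfies $\lambda_{\mathrm c}(\mu_\alpha)<\infty$ if $\alpha<b^2$, and $\lambda_{\mathrm c}(\mu_\alpha)=\infty$ if $\alpha\ge b^2$.
   Context: $G=\bigoplus_{i\in\mathbb{N}}\mathbb{Z}_b$ is the group of all sequences $(y^{(1)},y^{(2)},\dots)$ of elements of $\mathbb{Z}_b=\mathbb{Z}/b\mathbb{Z}$ with only finitely many non-zero terms, under componentwise addition. For $y\in G$, $\ell(y)$ is the position of the last non-zero term of $y$, with $\ell(\mathbf 0)=0$. For a finite symmetric measure $\mu$ on $G$ whose support generates $G$ (not necessarily normalised to be a probability measure) and $\lambda>0$, $G_\mu(\lambda)$ is the random multigraph with vertex set $G$ in which, independently for each unordered pair of distinct elements $g,h\in G$, the number of parallel edges between $g$ and $h$ is a Poisson random variable with mean $\lambda\,\mu(g^{-1}h)$ (here $g^{-1}h=h-g$). The percolation threshold is $$\lambda_{\mathrm c}(\mu)=\sup\{\lambda : \mathbb{P}(G_\mu(\lambda)\text{ has an infinite component})=0\}\in[0,\infty].$$ *)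

(* Defs.v *)
From HB Require Import structures.
From mathcomp Require Import all_boot all_order all_algebra.
From mathcomp Require Import finmap.
From mathcomp Require Import all_classical all_reals all_analysis.

Set Implicit Arguments.
Unset Strict Implicit.
Unset Printing Implicit Defensive.

Import Order.TTheory GRing.Theory Num.Theory.

Local Open Scope classical_set_scope.
Local Open Scope ring_scope.

(* The index n : nat stands for the position n + 1, so that y n is the
   coordinate y^(n+1). 'Z_b is Z/bZ only for b >= 2. *)
Definition dsum (b : nat) : Type := {fsfun nat -> 'Z_b with 0}.

HB.instance Definition _ (b : nat) :=
  Choice.copy (dsum b) {fsfun nat -> 'Z_b with 0}.

Section DirectSum.
Variable b : nat.
Implicit Types x y z : dsum b.

Definition dsum0 : dsum b := [fsfun].
Definition dsum_opp x : dsum b := [fsfun n in finsupp x => - x n].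
Definition dsum_add x y : dsum b :=
  [fsfun n in (finsupp x `|` finsupp y)%fset => x n + y n].

Lemma dsum0E n : dsum0 n = 0.
Proof. by rewrite fsfun0E. Qed.

Lemma dsum_oppE x n : dsum_opp x n = - x n.
Proof.
rewrite fsfunE; case: ifPn => // nx.
by rewrite (fsfun_dflt nx) oppr0.
Qed.

Lemma dsum_addE x y n : dsum_add x y n = x n + y n.
Proof.
rewrite fsfunE in_fsetU; case: ifPn => //; rewrite negb_or => /andP[nx ny].
by rewrite (fsfun_dflt nx) (fsfun_dflt ny) addr0.
Qed.

Lemma dsum_addA : associative dsum_add.
Proof. by move=> x y z; apply/fsfunP => n; rewrite !dsum_addE addrA. Qed.

Lemma dsum_addC : commutative dsum_add.
Proof. by move=> x y; apply/fsfunP => n; rewrite !dsum_addE addrC. Qed.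

Lemma dsum_add0 : left_id dsum0 dsum_add.
Proof. by move=> x; apply/fsfunP => n; rewrite dsum_addE dsum0E add0r. Qed.

Lemma dsum_addN : left_inverse dsum0 dsum_opp dsum_add.
Proof.
by move=> x; apply/fsfunP => n; rewrite dsum_addE dsum_oppE dsum0E addNr.
Qed.

HB.instance Definition _ := GRing.isZmodule.Build (dsum b)
  dsum_addA dsum_addC dsum_add0 dsum_addN.

Definition ell (y : dsum b) : nat := (\max_(n <- finsupp y) n.+1)%N.

Definition mu_pow (R : realType) (alpha : R) (y : dsum b) : R := alpha ^- ell y.

End DirectSum.

Definition edge (G : choiceType) := {e : {fset G} | #|` e|%fset == 2%N}.

Definition mutually_independent (R : realType) d (T : measurableType d)
    (P : probability T R) (I : choiceType) (X : I -> {RV P >-> nat}) : Prop :=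
  forall (J : {fset I}) (A : I -> set nat),
    P (\bigcap_(i in [set` J]) (X i @^-1` A i)) =
    (\prod_(i <- J) P (X i @^-1` A i))%E.

(* A realisation, on some probability space, of the random multigraph
   G_mu(lam); mult e is the number of parallel edges between the two elements
   of e. The measure mu is given by its (symmetric) mass function, so both
   orderings of e give the same mean. The nat argument of poisson_prob is
   ignored by the library. *)
Record percolation (R : realType) (G : zmodType) (mu : G -> R) (lam : R) := {
  perc_display : measure_display;
  perc_space : measurableType perc_display;
  perc_prob : probability perc_space R;
  mult : edge G -> {RV perc_prob >-> nat};
  mult_poisson : forall (e : edge G) (g h : G), val e = [fset g; h]%fset ->
    distribution perc_prob (mult e) =1 poisson_prob (lam * mu (h - g)) 0;
  mult_indep : mutually_independent mult
}.

Section Percolation.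
Variables (R : realType) (G : zmodType) (mu : G -> R).

Definition joined (lam : R) (X : percolation mu lam) (w : perc_space X)
    : rel G :=
  fun g h => `[< exists2 e : edge G, val e = [fset g; h]%fset
                                   & (0 < mult X e w)%N >].

Definition component (lam : R) (X : percolation mu lam) (w : perc_space X)
    (g : G) : set G :=
  [set h | exists2 p : seq G, path (joined w) g p & last g p = h].

Definition infinite_component_event (lam : R) (X : percolation mu lam)
    : set (perc_space X) :=
  [set w | exists g : G, infinite_set (component w g)].

End Percolation.

Arguments infinite_component_event {R G mu lam} X _.

(* The probability depends on the law of X lam only, hence lambda_c does not
   depend on the chosen realisations. The supremum is taken in [0, +oo],
   whence the added point 0. *)
Definition lambda_c (R : realType) (G : zmodType) (mu : G -> R)
    (X : forall lam : {posnum R}, percolation mu lam%:num)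
    : \bar R :=
  ereal_sup ([set 0%E] `|`
    [set (lam%:num)%:E | lam in [set lam : {posnum R} |
       perc_prob (X lam) (infinite_component_event (X lam)) = 0%E]]).

(* Main.v *)
Require Import Defs.
From mathcomp Require Import all_boot all_order all_algebra.
From mathcomp Require Import finmap.
From mathcomp Require Import all_classical all_reals all_analysis.
From mathcomp Require Import ring lra zify.

(* The group is exhausted by the balls [ell <= n], of cardinality [b ^ n].
   A ball of radius [n] sends edges out at total rate of order
   [(b ^ 2 / alpha) ^ n].

   If [b ^ 2 <= alpha] this rate is bounded, so a given ball is isolated with
   probability bounded below. Along radii [n0 + L j], [j < M], the events that
   the j-th ball has an edge into the (j+1)-st one are independent, and edges
   jumping further have probability O([M (b / alpha) ^ L]). Letting [L] and
   then [M] tend to infinity, almost surely some ball of radius at least [n0]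
   is isolated, and every component is finite.

   If [alpha < b ^ 2], renormalise with blocks of [N = b ^ k] subballs, where
   [2 alpha ^ k <= (N - 1) ^ 2]. A ball of radius [k (n + 1)] is good when at
   most one of its [N] subballs is bad and the clusters of the good ones are
   pairwise joined by an edge; its cluster then has at least
   [(N - 1) ^ (n + 1)] elements. The probability [p_n] of being bad satisfies
   [p_(n+1) <= N ^ 2 (p_n ^ 2 + e_n)] with [e_n = exp (- c 2 ^ n)] and [c] of
   order [lam]. For [lam] large the sum of the [p_n] is less than 1, so with
   positive probability all the balls around 0 are good; their clusters all
   contain 0, whose component is infinite. *)

Set Implicit Arguments.
Unset Strict Implicit.
Unset Printing Implicit Defensive.

Import Order.TTheory GRing.Theory Num.Theory.
Import numFieldNormedType.Exports.

Local Open Scope classical_set_scope.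
Local Open Scope ring_scope.

(** * Real-valued probabilities *)


Section RealProbability.
Context d (T : measurableType d) (R : realType) (P : probability T R).

Definition pr (A : set T) : R := fine (P A).

Lemma prE A : measurable A -> P A = (pr A)%:E.
Proof. by move=> mA; rewrite fineK // fin_num_measure. Qed.

Lemma pr_ge0 A : 0 <= pr A.
Proof. exact: fine_ge0. Qed.

Lemma pr_set0 : pr set0 = 0.
Proof. by rewrite /pr measure0. Qed.

Lemma le_pr A B : measurable A -> measurable B -> A `<=` B -> pr A <= pr B.
Proof.
by move=> mA mB AB; rewrite -lee_fin -!prE //; apply: le_measure; rewrite ?inE.
Qed.

Lemma pr_le1 A : measurable A -> pr A <= 1.
Proof. by move=> mA; rewrite -lee_fin -prE // probability_le1. Qed.

Lemma prU A B : measurable A -> measurable B -> A `&` B = set0 ->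
  pr (A `|` B) = pr A + pr B.
Proof.
move=> mA mB AB; apply: EFin_inj.
by rewrite EFinD -!prE //; [exact: measureU|exact: measurableU].
Qed.

Lemma prDI A B : measurable A -> measurable B ->
  pr A = pr (A `\` B) + pr (A `&` B).
Proof.
move=> mA mB; rewrite -prU.
- by congr pr; rewrite setUC setUIDK.
- exact: measurableD.
- exact: measurableI.
- by apply/seteqP; split=> x //= [[_ nBx] [_ /nBx]].
Qed.

Lemma prC A : measurable A -> pr (~` A) = 1 - pr A.
Proof.
move=> mA; apply: EFin_inj.
by rewrite EFinB -!prE //; [exact: probability_setC|exact: measurableC].
Qed.

Lemma pr_leU A B : measurable A -> measurable B ->
  pr (A `|` B) <= pr A + pr B.
Proof.
move=> mA mB; rewrite (prDI (measurableU _ _ mA mB) mB) lerD //.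
- apply: le_pr; [exact/measurableD/mB/measurableU|by []|by move=> x [[]]].
- apply: le_pr; [exact/measurableI/mB/measurableU|by []|by move=> x []].
Qed.

Lemma measurable_has (I : eqType) (s : seq I) (A : I -> set T) :
  (forall i, measurable (A i)) ->
  measurable [set w | exists2 i, i \in s & A i w].
Proof.
move=> mA; elim: s => [|i s IH].
  by rewrite (_ : mkset _ = set0) //; apply/seteqP; split=> w [].
rewrite (_ : mkset _ = A i `|` [set w | exists2 i, i \in s & A i w]).
  exact: measurableU.
apply/seteqP; split=> w /=.
  by move=> [j]; rewrite inE => /predU1P[->|js Aj]; [left|right; exists j].
case=> [Ai|[j js Aj]]; first by exists i; rewrite ?mem_head.
by exists j; rewrite // inE js orbT.
Qed.

Lemma pr_le_has (I : eqType) (s : seq I) (A : I -> set T) :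
  (forall i, measurable (A i)) ->
  pr [set w | exists2 i, i \in s & A i w] <= \sum_(i <- s) pr (A i).
Proof.
move=> mA; elim: s => [|i s IH].
  rewrite big_nil (_ : mkset _ = set0) ?pr_set0 //.
  by apply/seteqP; split=> w [].
rewrite big_cons.
apply: le_trans (lerD (lexx _) IH).
rewrite (_ : mkset _ = A i `|` [set w | exists2 i, i \in s & A i w]).
  by apply: pr_leU => //; exact: measurable_has.
apply/seteqP; split=> w /=.
  by move=> [j]; rewrite inE => /predU1P[->|js Aj]; [left|right; exists j].
case=> [Ai|[j js Aj]]; first by exists i; rewrite ?mem_head.
by exists j; rewrite // inE js orbT.
Qed.

Lemma pr_bigcup_nondecreasing (F : nat -> set T) (c : R) :
  (forall n, measurable (F n)) -> nondecreasing_seq F ->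
  (forall n, pr (F n) <= c) -> pr (\bigcup_n F n) <= c.
Proof.
move=> mF ndF Fc.
have mU : measurable (\bigcup_n F n) by exact: bigcupT_measurable.
rewrite -lee_fin -prE //.
have cF := nondecreasing_cvg_mu mF mU ndF (mu := P).
rewrite -(cvg_lim _ cF) //; apply: lime_le.
  by apply/cvg_ex; eexists; exact: cF.
by apply: nearW => n /=; rewrite prE // lee_fin.
Qed.

Lemma pr_partition (J : choiceType) (F : T -> J) (s : seq J) (A : set T) :
  uniq s -> (forall w, F w \in s) ->
  (forall j, measurable (A `&` F @^-1` [set j])) ->
  pr A = \sum_(j <- s) pr (A `&` F @^-1` [set j]).
Proof.
move=> us Fs mAF.
have {1}-> : A = [set w | exists2 j, j \in s & (A `&` F @^-1` [set j]) w].
  by apply/seteqP; split=> w /= => [Aw|[j _ []]//]; exists (F w).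
elim: s us {Fs} => [_|j s IH /= /andP[js us]].
  rewrite big_nil (_ : mkset _ = set0) ?pr_set0 //.
  by apply/seteqP; split=> w [].
rewrite big_cons -IH // -prU //.
- congr pr; apply/seteqP; split=> w /=.
    by move=> [i]; rewrite inE => /predU1P[->|js' Aj]; [left|right; exists i].
  case=> [Ai|[i is_ Ai]]; first by exists j; rewrite ?mem_head.
  by exists i; rewrite // inE is_ orbT.
- exact: measurable_has.
- apply/seteqP; split=> w //= [[_ /= Fj] [i is_ [_ /= Fi]]].
  by move: js; rewrite -Fj Fi is_.
Qed.

End RealProbability.

(** * Events depending on finitely many variables *)


Section FiniteDependence.
Context d (T : measurableType d) (R : realType) (P : probability T R).
Context (I : choiceType) (X : I -> {RV P >-> nat}).
Hypothesis indepX : mutually_independent X.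
Local Notation pr := (pr P).

Definition occupied i w := (0 < X i w)%N.

(** Only the positivity of each variable is kept: connectivity depends on nothing else, and [cfg J]
    takes finitely many values, so that conditioning on it is a finite sum over atoms. *)
Definition cfg (J : {fset I}) w : {fset I} :=
  [fset i in J | occupied i w]%fset.

Definition depends (J : {fset I}) (A : set T) :=
  forall w w', cfg J w = cfg J w' -> A w -> A w'.

Lemma cfgP (J : {fset I}) w w' :
  cfg J w = cfg J w' <-> {in J, forall i, occupied i w = occupied i w'}.
Proof.
split=> [/fsetP e i iJ|e].
  by have := e i; rewrite !inE /= iJ.
by apply/fsetP => i; rewrite !inE /=; case: (boolP (i \in J)) => //= /e.
Qed.

Lemma cfgW (J J' : {fset I}) w w' :
  (J `<=` J')%fset -> cfg J' w = cfg J' w' -> cfg J w = cfg J w'.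
Proof. by move=> /fsubsetP JJ' /cfgP e; apply/cfgP => i /JJ'; exact: e. Qed.

Lemma dependsW (J J' : {fset I}) (A : set T) :
  (J `<=` J')%fset -> depends J A -> depends J' A.
Proof.
by move=> JJ' dA w w' /(cfgW JJ'); exact: dA.
Qed.

Lemma depends_setI J A B : depends J A -> depends J B -> depends J (A `&` B).
Proof. by move=> dA dB w w' e [Aw Bw]; split; [exact: dA Aw|exact: dB Bw]. Qed.

Lemma depends_setC J A : depends J A -> depends J (~` A).
Proof. by move=> dA w w' e nA Aw'; apply: nA; apply: dA Aw'. Qed.

Definition level (S : {fset I}) i := [set n : nat | (0 < n)%N = (i \in S)].

Lemma cfg_levelE (J S : {fset I}) : (S `<=` J)%fset ->
  cfg J @^-1` [set S] = \bigcap_(i in [set` J]) (X i @^-1` level S i).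
Proof.
move=> /fsubsetP SJ; apply/seteqP; split=> w /=.
  by move=> <- i /= iJ; rewrite /level /= !inE /= iJ.
move=> H; apply/fsetP => i; rewrite !inE /=.
case: (boolP (i \in J)) => [/H //|niJ] /=.
by apply/esym/negbTE; apply: contra niJ => /SJ.
Qed.

Lemma measurable_preimage_nat i (B : set nat) : measurable (X i @^-1` B).
Proof. exact: measurable_funPTI. Qed.

Lemma measurable_cfg (J S : {fset I}) : measurable (cfg J @^-1` [set S]).
Proof.
have [SJ|nSJ] := boolP (S `<=` J)%fset; last first.
  rewrite (_ : _ @^-1` _ = set0) //; apply/seteqP; split=> w //= e.
  by move: nSJ; rewrite -e fset_sub.
rewrite cfg_levelE //; apply: fin_bigcap_measurable.
  exact: finite_fset.
by move=> i _; exact: measurable_preimage_nat.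
Qed.

(** The intersection of the two atoms is again an atom, that of the union of [S1] and [S2]. Mutual
    independence turns each of the three probabilities into a product over indices, and the product
    over the disjoint union splits. *)
Lemma pr_cfgI (J1 J2 S1 S2 : {fset I}) : [disjoint J1 & J2]%fset ->
  (S1 `<=` J1)%fset -> (S2 `<=` J2)%fset ->
  pr (cfg J1 @^-1` [set S1] `&` cfg J2 @^-1` [set S2]) =
  pr (cfg J1 @^-1` [set S1]) * pr (cfg J2 @^-1` [set S2]).
Proof.
move=> dJ sS1 sS2.
have S12 : (S1 `|` S2 `<=` J1 `|` J2)%fset by exact: fsetUSS.
have mcfg := measurable_cfg.
apply: EFin_inj; rewrite EFinM -!prE //; last exact: measurableI.
have l1 i : i \in J1 -> level (S1 `|` S2)%fset i = level S1 i.
  move=> iJ1; rewrite /level in_fsetU.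
  rewrite (negbTE (contra (fsubsetP sS2 i) _)) ?orbF //.
  by move/fdisjointP : dJ; apply.
have l2 i : i \in J2 -> level (S1 `|` S2)%fset i = level S2 i.
  move=> iJ2; rewrite /level in_fsetU.
  rewrite (negbTE (contra (fsubsetP sS1 i) _)) ?orFb //.
  by move: dJ; rewrite fdisjoint_sym => /fdisjointP; apply.
have -> : cfg J1 @^-1` [set S1] `&` cfg J2 @^-1` [set S2] =
    cfg (J1 `|` J2)%fset @^-1` [set (S1 `|` S2)%fset].
  rewrite !cfg_levelE //; apply/seteqP; split=> w /=.
    move=> [H1 H2] i /=; rewrite in_fsetU => /orP[] iJ.
      by rewrite l1 //; exact: H1.
    by rewrite l2 //; exact: H2.
  move=> H; split=> i /= iJ.
    by have := H i; rewrite /= in_fsetU iJ l1 //; apply.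
  by have := H i; rewrite /= in_fsetU iJ orbT l2 //; apply.
have E1 : [fset x in (J1 `|` J2) | x \in mem J1]%fset = J1.
  by apply/fsetP => i; rewrite !inE /=; case: (i \in J1); rewrite ?andbF.
have E2 : [fset x in (J1 `|` J2) | x \notin mem J1]%fset = J2.
  apply/fsetP => i; rewrite !inE /=.
  have := (fdisjointP dJ) i; case: (i \in J1).
    by move=> /(_ isT)/negbTE ->.
  by rewrite andbT.
rewrite !cfg_levelE // !indepX (big_fsetID _ (mem J1)) /= E1 E2.
congr (_ * _)%E; first by apply: eq_big_seq => i /l1 ->.
by apply: eq_big_seq => i /l2 ->.
Qed.

Lemma depends_atom J A w : depends J A -> A w ->
  A `&` cfg J @^-1` [set cfg J w] = cfg J @^-1` [set cfg J w].
Proof.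
move=> dA Aw; apply/setIidr => w' /= e; exact: dA Aw.
Qed.

(** An event that depends on [J] is the union of the finitely many atoms of [cfg J] that meet it. *)
Lemma measurable_depends J A : depends J A -> measurable A.
Proof.
move=> dA; rewrite (_ : A = [set w | exists2 S, S \in fpowerset J
    & (A `&` cfg J @^-1` [set S]) w]).
  apply: measurable_has => S.
  have [[w [Aw <-]]|/set0P/negP/negPn/eqP ->] :=
    pselect ((A `&` cfg J @^-1` [set S]) !=set0).
    by rewrite depends_atom //; exact: measurable_cfg.
  exact: measurable0.
apply/seteqP; split=> w /= => [Aw|[S _ []]//].
by exists (cfg J w); rewrite ?fpowersetE ?fset_sub.
Qed.

Lemma pr_cfg_partition J A : measurable A ->
  pr A = \sum_(S <- fpowerset J) pr (A `&` cfg J @^-1` [set S]).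
Proof.
move=> mA; apply: pr_partition => [|w|S]; first exact: fset_uniq.
  by rewrite fpowersetE fset_sub.
by apply: measurableI => //; exact: measurable_cfg.
Qed.

Lemma pr_cfgI_depends J1 J2 S B : [disjoint J1 & J2]%fset ->
  (S `<=` J1)%fset -> depends J2 B ->
  pr (cfg J1 @^-1` [set S] `&` B) = pr (cfg J1 @^-1` [set S]) * pr B.
Proof.
move=> dJ SJ dB; have mB := measurable_depends dB.
rewrite (pr_cfg_partition J2 mB) mulr_sumr.
rewrite (pr_cfg_partition J2); last exact: measurableI (measurable_cfg _ _) mB.
apply: eq_big_seq => S' S'J; rewrite -setIA.
have [[w [Bw <-]]|/set0P/negP/negPn/eqP ->] :=
    pselect ((B `&` cfg J2 @^-1` [set S']) !=set0).
  by rewrite depends_atom // pr_cfgI // fset_sub.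
by rewrite setI0 pr_set0 mulr0.
Qed.

(* Conditioning on the configuration in [J1]: given that configuration, [C]
   is contained in an event that depends on [J2] only. *)
Lemma pr_le_cond J1 J2 (A C : set T) (eps : R) : [disjoint J1 & J2]%fset ->
  depends J1 A -> measurable C -> C `<=` A ->
  (forall w0, A w0 -> exists2 B, depends J2 B /\ pr B <= eps &
     C `&` cfg J1 @^-1` [set cfg J1 w0] `<=` B) ->
  pr C <= pr A * eps.
Proof.
move=> dJ dA mC CA H; have mA := measurable_depends dA.
rewrite (pr_cfg_partition J1 mC) (pr_cfg_partition J1 mA) mulr_suml.
rewrite big_seq [leRHS]big_seq; apply: ler_sum => S SJ.
have [[w [Aw <-]]|/set0P/negP/negPn/eqP AS0] :=
    pselect ((A `&` cfg J1 @^-1` [set S]) !=set0); last first.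
  rewrite AS0 (_ : C `&` _ = set0) ?pr_set0 ?mul0r //.
  by apply/seteqP; split=> w // [Cw Sw]; rewrite -AS0; split=> //; exact: CA.
have [B [dB Be] CB] := H w Aw.
rewrite (depends_atom dA Aw).
have cB := ler_wpM2l (pr_ge0 P (cfg J1 @^-1` [set cfg J1 w])) Be.
apply: le_trans cB.
rewrite -(pr_cfgI_depends dJ) ?fset_sub //.
have mc := measurable_cfg J1 (cfg J1 w).
apply: le_pr; [exact: measurableI|
  exact: measurableI mc (measurable_depends dB)|].
by move=> w' Cw'; split; [case: Cw'|exact: CB].
Qed.

(** The case of [pr_le_cond] in which the bounding event is the same for all configurations. *)
Lemma pr_le_indep J1 J2 (A B : set T) (eps : R) : [disjoint J1 & J2]%fset ->
  depends J1 A -> depends J2 B -> pr B <= eps ->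
  pr (A `&` B) <= pr A * eps.
Proof.
move=> dJ dA dB Be; apply: (pr_le_cond dJ dA).
- exact: measurableI (measurable_depends dA) (measurable_depends dB).
- by move=> w [].
- by move=> w _; exists B => // w' [[]].
Qed.

Lemma pr_vacant (J : {fset I}) :
  pr [set w | {in J, forall i, ~~ occupied i w}] =
  \prod_(i <- J) pr (X i @^-1` [set 0%N]).
Proof.
have HP := indepX J (fun=> [set 0%N]); apply: EFin_inj.
rewrite -prodEFin; under [RHS]eq_bigr => i _.
  rewrite -prE; last exact: measurable_preimage_nat.
  over.
rewrite -HP -prE; last first.
  apply: (@measurable_depends J) => w w' /cfgP e H i iJ.
  by rewrite -e //; exact: H.
congr (P _); apply/seteqP; split=> w /= H i /= iJ; have := H i iJ => /=.
  by rewrite /occupied -eqn0Ngt => /eqP.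
by rewrite /occupied => ->.
Qed.

End FiniteDependence.


(** * Edges inside a finite vertex set and between two of them *)

Section Edges.
Variables (G : choiceType) (e0 : edge G).
Implicit Types (g h : G) (A K : {fset G}).

(** The default [e0] is taken only when both entries coincide; it makes the map total. *)
Definition mkedge (p : G * G) : edge G := insubd e0 [fset p.1; p.2]%fset.

Lemma val_mkedge g h : g != h -> val (mkedge (g, h)) = [fset g; h]%fset.
Proof. by move=> gh; rewrite val_insubd cardfs2 gh. Qed.

Definition edges_in A : {fset edge G} :=
  [fset e in pmap insub (fpowerset A)]%fset.

Lemma in_edges_in A e : (e \in edges_in A) = (val e `<=` A)%fset.
Proof. by rewrite inE /= mem_pmap_sub fpowersetE. Qed.

Definition edges_between A K : {fset edge G} :=
  [fset mkedge p | p in (A `*` K)%fset]%fset.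

Lemma edges_in_sub A K : (A `<=` K)%fset -> (edges_in A `<=` edges_in K)%fset.
Proof.
by move=> AK; apply/fsubsetP => e; rewrite !in_edges_in => /fsubset_trans; apply.
Qed.

Lemma edge_neq0 (e : edge G) : exists x, x \in val e.
Proof.
have [e_0|//] := fset_0Vmem (val e); last by case=> x; exists x.
by have := valP e; rewrite e_0 cardfs0.
Qed.

Lemma edges_in_disjoint A K : [disjoint A & K]%fset ->
  [disjoint edges_in A & edges_in K]%fset.
Proof.
move=> /fdisjointP dAK; apply/fdisjointP => e; rewrite !in_edges_in => /fsubsetP eA.
by have [x xe] := edge_neq0 e; apply/negP => /fsubsetP/(_ x xe); exact/negP/dAK/eA.
Qed.

Lemma edges_between_disjoint A K : [disjoint A & K]%fset ->
  [disjoint edges_in A & edges_between A K]%fset.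
Proof.
move=> /fdisjointP dAK; apply/fdisjointP => e; rewrite in_edges_in => /fsubsetP eA.
apply/negP => /imfsetP[[g h] /=]; rewrite in_fsetM /= => /andP[gA hK] ee.
have gh : g != h by apply: contraTneq hK => <-; exact: dAK.
have := eA h; rewrite ee val_mkedge // !inE eqxx orbT => /(_ isT) /dAK.
by rewrite hK.
Qed.

Lemma edges_between_disjointr A K : [disjoint A & K]%fset ->
  [disjoint edges_in K & edges_between A K]%fset.
Proof.
move=> dAK; apply/fdisjointP => e; rewrite in_edges_in => /fsubsetP eK.
apply/negP => /imfsetP[[g h] /=]; rewrite in_fsetM /= => /andP[gA hK] ee.
have gnK : g \notin K by move/fdisjointP: dAK; exact.
have gh : g != h by apply: contraTneq hK => <-.
have := eK g; rewrite ee val_mkedge // !inE eqxx => /(_ isT).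
by rewrite (negbTE gnK).
Qed.

(** Disjointness of [A] and [K] tells which endpoint of the unordered pair comes first. *)
Lemma mkedge_inj A K : [disjoint A & K]%fset ->
  {in (A `*` K)%fset &, injective mkedge}.
Proof.
move=> /fdisjointP dAK [g h] [g' h']; rewrite !in_fsetM /=.
move=> /andP[gA hK] /andP[g'A h'K] /(congr1 val).
have neq a c : a \in A -> c \in K -> a != c.
  by move=> aA; apply: contraTneq => <-; exact: dAK.
rewrite !val_mkedge ?neq // => /fsetP e.
have := e g; rewrite !inE eqxx (negbTE (neq _ _ gA h'K)) orbF => /esym/eqP <-.
have := e h; rewrite !inE eqxx orbT [h == g']eq_sym.
by rewrite (negbTE (neq _ _ g'A hK)) => /esym/eqP <-.
Qed.

End Edges.

Lemma poisson_prob_set0 (R : realType) (rate : R) : 0 <= rate ->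
  poisson_prob rate 0 [set 0%N] = (expR (- rate))%:E.
Proof.
rewrite /poisson_prob le_eqVlt => /predU1P[<-|r0].
  by rewrite ltxx oppr0 expR0 diracE mem_set.
rewrite r0 esum_set1.
  by rewrite /poisson_pmf r0 expr0 mul1r fact0 invr1 mul1r.
by rewrite lee_fin poisson_pmf_ge0.
Qed.

(** * Probability that two finite vertex sets are not joined *)

Section Links.
Variables (R : realType) (G : zmodType) (mu : G -> R) (lam : R).
Variables (X : percolation mu lam) (e0 : edge G).
Hypotheses (mu_ge0 : forall g, 0 <= mu g) (lam_ge0 : 0 <= lam).
Local Notation pr := (pr (perc_prob X)).
Local Notation cfg := (cfg (@mult _ _ _ _ X)).
Local Notation depends := (depends (@mult _ _ _ _ X)).
Implicit Types (g h : G) (A K : {fset G}) (w : perc_space X).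

Lemma joinedE w g h :
  joined w g h = (g != h) && occupied (@mult _ _ _ _ X) (mkedge e0 (g, h)) w.
Proof.
apply/asboolP/andP => [[e ee e_gt0]|[gh o]]; last first.
  by exists (mkedge e0 (g, h)) => //; exact: val_mkedge.
have gh : g != h.
  by have := valP e; rewrite /= ee cardfs2; case: (g != h).
split=> //; suff <- : e = mkedge e0 (g, h) by [].
by apply: val_inj; rewrite val_mkedge.
Qed.

Lemma joined_edges_in A w w' : cfg (edges_in A) w = cfg (edges_in A) w' ->
  {in A &, joined w =2 joined w'}.
Proof.
move=> /cfgP e g h gA hA; rewrite !joinedE; have [//|gh /=] := eqVneq g h.
apply: e; rewrite in_edges_in val_mkedge //; apply/fsubsetP => x.
by rewrite !inE => /orP[] /eqP ->.
Qed.

Lemma joined_edges_between A K w w' :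
  cfg (edges_between e0 A K) w = cfg (edges_between e0 A K) w' ->
  {in A & K, joined w =2 joined w'}.
Proof.
move=> /cfgP e g h gA hK; rewrite !joinedE; have [//|gh /=] := eqVneq g h.
by apply: e; apply/imfsetP; exists (g, h); rewrite //= in_fsetM gA.
Qed.

Definition unlinked A K : set (perc_space X) :=
  [set w | {in A & K, forall g h, ~~ joined w g h}].

Lemma depends_unlinked A K A' K' : (A' `<=` A)%fset -> (K' `<=` K)%fset ->
  depends (edges_between e0 A K) (unlinked A' K').
Proof.
move=> /fsubsetP A'A /fsubsetP K'K w w' e H g h gA hK.
by rewrite -(joined_edges_between e) ?A'A ?K'K //; exact: H.
Qed.

Lemma depends_unlinked_in A A' K' : (A' `<=` A)%fset -> (K' `<=` A)%fset ->
  depends (edges_in A) (unlinked A' K').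
Proof.
move=> /fsubsetP A'A /fsubsetP K'A w w' e H g h gA hK.
by rewrite -(joined_edges_in e (A'A _ gA) (K'A _ hK)); exact: H.
Qed.

Lemma measurable_unlinked A K : measurable (unlinked A K).
Proof. exact: measurable_depends (depends_unlinked (fsubset_refl _) (fsubset_refl _)). Qed.

Lemma pr_mult0 g h : g != h ->
  pr (mult X (mkedge e0 (g, h)) @^-1` [set 0%N]) = expR (- (lam * mu (h - g))).
Proof.
move=> gh; have := mult_poisson X (val_mkedge e0 gh) [set 0%N].
rewrite poisson_prob_set0 ?mulr_ge0 // => H.
exact: (congr1 fine H).
Qed.

(** Distinct pairs give distinct edges, so the vacancy probabilities multiply and the Poisson rates
    add up in the exponent. *)
Lemma pr_unlinked A K : [disjoint A & K]%fset ->
  pr (unlinked A K) = expR (- (lam * \sum_(g <- A) \sum_(h <- K) mu (h - g))).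
Proof.
move=> dAK.
have neq a c : a \in A -> c \in K -> a != c.
  by move=> aA; apply: contraTneq => <-; move/fdisjointP: dAK; exact.
rewrite (_ : unlinked A K = [set w | {in edges_between e0 A K, forall e,
    ~~ occupied (@mult _ _ _ _ X) e w}]).
  rewrite (pr_vacant (@mult_indep _ _ _ _ X)) big_imfset /=; last exact: mkedge_inj.
  rewrite mulr_sumr -sumrN expR_sum.
  under [RHS]eq_bigr do rewrite mulr_sumr -sumrN expR_sum.
  (* The product over the finite set of pairs is reindexed by a list of pairs, which unfolds into an
     iterated product. *)
  rewrite (perm_big [seq (g, h) | g <- A, h <- K]) /=; last first.
    apply: uniq_perm; first exact: fset_uniq.
      by apply: allpairs_uniq; rewrite ?fset_uniq // => -[? ?] [? ?].
    move=> [g h]; rewrite in_fsetM /=; apply/andP/allpairsP.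
      by move=> [gA hK]; exists (g, h).
    by case=> -[g' h'] /= [gA hK [-> ->]].
  rewrite big_allpairs big_seq [RHS]big_seq; apply: eq_bigr => g gA.
  rewrite big_seq [RHS]big_seq; apply: eq_bigr => h hK.
  by rewrite pr_mult0 // neq.
apply/seteqP; split=> w /= H.
  move=> _ /imfsetP[[g h] /= + ->]; rewrite in_fsetM /= => /andP[gA hK].
  by have := H _ _ gA hK; rewrite joinedE neq.
move=> g h gA hK; rewrite joinedE negb_and H ?orbT //.
by apply/imfsetP; exists (g, h); rewrite //= in_fsetM gA.
Qed.

End Links.
Arguments unlinked {R G mu lam} X A K _.

(** * Blocks and balls of the direct sum *)


Section Blocks.
Variable b : nat.
Implicit Types (x y z : dsum b) (a n k : nat).

Definition block_elt a n (f : {ffun 'I_n -> 'Z_b}) : dsum b :=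
  [fsfun i in [fset i in iota a n]%fset =>
     if insub (i - a)%N is Some j then f j else 0].

(** The subgroup of elements supported on the coordinates [a], ..., [a + n - 1]. It is the ball of
    radius [n] for [a = 0], and in general a set of representatives of the cosets of the ball of
    radius [a] in the ball of radius [a + n]. *)
Definition block a n : {fset dsum b} :=
  [fset block_elt a f | f in {: {ffun 'I_n -> 'Z_b}}]%fset.

Lemma block_eltE a n (f : {ffun 'I_n -> 'Z_b}) (j : 'I_n) :
  block_elt a f (a + j)%N = f j.
Proof.
rewrite /block_elt fsfunE !inE /= mem_iota leq_addr ltn_add2l ltn_ord /=.
rewrite addKn; case: insubP => [u _ /val_inj -> //|].
by rewrite ltn_ord.
Qed.

Lemma in_block a n x :
  (x \in block a n) = all (fun i => a <= i < a + n)%N (finsupp x).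
Proof.
apply/imfsetP/allP => [[f _ ->] i|H].
  rewrite mem_finsupp /block_elt fsfunE !inE /= mem_iota.
  by case: ifP => //; rewrite eqxx.
exists [ffun j : 'I_n => x (a + j)%N]; first by rewrite inE.
apply/fsfunP => i; have [/andP[ai ian]|nai] := boolP (a <= i < a + n)%N.
  have lti : (i - a < n)%N by rewrite ltn_subLR.
  have := block_eltE a [ffun j : 'I_n => x (a + j)%N] (Ordinal lti).
  by rewrite ffunE /= subnKC.
rewrite /block_elt fsfunE !inE /= mem_iota (negbTE nai).
by apply: fsfun_dflt; apply: contra nai; exact: H.
Qed.

Lemma in_blockP a n x :
  reflect (forall i, ~~ (a <= i < a + n)%N -> x i = 0) (x \in block a n).
Proof.
rewrite in_block; apply: (iffP allP) => H i.
  by move=> ni; apply: fsfun_dflt; apply: contra ni; exact: H.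
by rewrite mem_finsupp; apply: contraNT => /H ->.
Qed.

Lemma card_block a n : (2 <= b)%N -> #|` block a n| = (b ^ n)%N.
Proof.
move=> b_ge2; rewrite card_imfset /=; last first.
  move=> f g fg; apply/ffunP => j.
  by rewrite -(block_eltE a f) fg block_eltE.
by rewrite -cardT card_ffun !card_ord Zp_cast.
Qed.

Lemma block0 a n : 0 \in block a n.
Proof. by apply/in_blockP => i _; exact: dsum0E. Qed.

Lemma blockB a n x y : x \in block a n -> y \in block a n ->
  x - y \in block a n.
Proof.
move=> /in_blockP xB /in_blockP yB; apply/in_blockP => i ni.
by rewrite dsum_addE dsum_oppE xB // yB // subrr.
Qed.

Lemma blockN a n x : x \in block a n -> - x \in block a n.
Proof. by rewrite -sub0r; apply: blockB; exact: block0. Qed.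

Lemma blockD a n x y : x \in block a n -> y \in block a n ->
  x + y \in block a n.
Proof. by move=> xB /blockN yB; rewrite -[y]opprK; exact: blockB. Qed.

Definition ellball n := block 0 n.

Lemma in_ellball n x : (x \in ellball n) = (ell x <= n)%N.
Proof.
rewrite in_block /ell; apply/allP/bigmax_leqP_seq => [H i /H//|H i iS].
by rewrite leq0n add0n; exact: H.
Qed.

Lemma in_ellballP n x :
  reflect (forall i, (n <= i)%N -> x i = 0) (x \in ellball n).
Proof.
apply: (iffP (in_blockP _ _ _)) => H i ni; apply: H; last by lia.
by rewrite add0n leq0n /= -leqNgt.
Qed.

Lemma ellball_sub m n : (m <= n)%N -> (ellball m `<=` ellball n)%fset.
Proof. by move=> mn; apply/fsubsetP => x; rewrite !in_ellball => /leq_trans; apply. Qed.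

Lemma block_sub_ball a n : (block a n `<=` ellball (a + n))%fset.
Proof.
apply/fsubsetP => x /in_blockP xB; apply/in_ellballP => i ni; apply: xB.
by lia.
Qed.

Lemma block_ball_inj a n z z' : z \in block a n -> z' \in block a n ->
  z - z' \in ellball a -> z = z'.
Proof.
move=> zB z'B /in_ellballP zz'; apply/eqP; rewrite -subr_eq0; apply/eqP.
apply/fsfunP => i; rewrite fsfun0E; have [/zz' //|ia] := leqP a i.
by move/in_blockP : (blockB zB z'B); apply; lia.
Qed.

(** The ultrametric property: each ball is a subgroup, so subtracting [g] does not change membership
    in the balls of radius at least [n]. *)
Lemma ellB g h n : g \in ellball n -> h \notin ellball n -> ell (h - g) = ell h.
Proof.
move=> gn hn; have nh : (n < ell h)%N by rewrite ltnNge -in_ellball.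
have Hm m : (n <= m)%N -> (h - g \in ellball m) = (h \in ellball m).
  move=> nm; have gm := fsubsetP (ellball_sub nm) _ gn.
  apply/idP/idP => [hg|hm]; last exact: blockB.
  by rewrite -(subrK g h); exact: blockD.
apply/eqP; rewrite eqn_leq -in_ellball Hm ?(ltnW nh) // in_ellball leqnn /=.
rewrite -in_ellball; have : h - g \in ellball (ell (h - g)) by rewrite in_ellball.
have [/Hm -> //|lt] := leqP n (ell (h - g)).
move=> hg; suff : h \in ellball n by rewrite (negbTE hn).
rewrite -(subrK g h); apply: blockD => //.
exact: (fsubsetP (ellball_sub (ltnW lt))).
Qed.

Definition delta0 : dsum b := block_elt 0 [ffun _ : 'I_1 => 1].

Lemma delta0_neq0 : delta0 != 0.
Proof.
apply/eqP => /(congr1 (fun x : dsum b => x 0%N)).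
have := block_eltE 0 [ffun _ : 'I_1 => 1 : 'Z_b] ord0.
rewrite addn0 ffunE => ->; rewrite dsum0E => /eqP.
by rewrite oner_eq0.
Qed.

Definition edge0 : edge (dsum b).
Proof.
by exists [fset delta0; 0]%fset; rewrite cardfs2 delta0_neq0.
Defined.

End Blocks.


(** * Infinite components and their measurability *)

Lemma path_exit (T : eqType) (S : pred T) (e : rel T) x p :
  path e x p -> S x -> ~~ S (last x p) ->
  exists y z, [/\ S y, ~~ S z & e y z].
Proof.
elim: p x => [|y p IH] x /=; first by move=> _ ->.
move=> /andP[exy pyp] Sx Sl; have [Sy|nSy] := boolP (S y); first exact: IH Sl.
by exists x, y.
Qed.

Section InfiniteComponents.
Variables (b : nat) (R : realType) (mu : dsum b -> R) (lam : R).
Variable X : percolation mu lam.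

Lemma infinite_setP (C : set (dsum b)) :
  infinite_set C <-> forall n, exists2 h, C h & h \notin ellball b n.
Proof.
split=> [iC n|H fC].
  apply: contrapT => nH; apply: iC.
  apply: (@sub_finite_set _ _ [set` ellball b n]); last exact: finite_fset.
  move=> h Ch /=; apply: contrapT => hn; apply: nH; exists h => //.
  exact/negP.
have [h Ch] := H (\max_(h <- fset_set C) ell h)%N.
rewrite in_ellball => /negP; apply.
by apply: leq_bigmax_seq => //; rewrite in_fset_set // inE.
Qed.

Lemma measurable_joined g h : measurable [set w : perc_space X | joined w g h].
Proof.
rewrite (_ : mkset _ = ~` unlinked X [fset g]%fset [fset h]%fset).
  by apply: measurableC; exact: (measurable_unlinked X (edge0 b)).
apply/seteqP; split=> w /= => [j H|].
  by have := H g h; rewrite !inE !eqxx j => /(_ isT isT).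
move=> H; apply: contrapT => /negP j; apply: H => g' h'.
by rewrite !inE => /eqP -> /eqP ->.
Qed.

(** Vertices and finite paths are countable, and a component is infinite when for every [n] some
    path from its base point ends outside the ball of radius [n]. *)
Lemma measurable_infinite_component : measurable (infinite_component_event X).
Proof.
have mp g p : measurable [set w : perc_space X | path (joined w) g p].
  elim: p g => [|h p IH] g.
    rewrite (_ : mkset _ = setT); first exact: measurableT.
    by apply/seteqP; split.
  rewrite (_ : mkset _ =
    [set w | joined w g h] `&` [set w : perc_space X | path (joined w) h p]).
    by apply: measurableI => //; exact: measurable_joined.
  by apply/seteqP; split=> w /= => [/andP//|[-> ->]].
rewrite (_ : infinite_component_event X = \bigcup_g \bigcap_n
  \bigcup_p [set w | path (joined w) g p && (last g p \notin ellball b n)]).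
  apply: countable_bigcupT_measurable => [|g].
    exact: (@countableP (dsum b)).
  apply: bigcapT_measurable => n.
  apply: countable_bigcupT_measurable => [|p].
    exact: (@countableP (seq (dsum b))).
  have [l|l] := boolP (last g p \notin ellball b n).
    by rewrite (_ : mkset _ = [set w | path (joined w) g p]) //;
      apply/funext => w /=; rewrite andbT.
  by rewrite (_ : mkset _ = set0) //; apply/funext => w /=; rewrite andbF falseE.
apply/seteqP; split=> w /=.
  move=> [g /infinite_setP H]; exists g => // n _.
  have [h [p pp <-] lp] := H n; by exists p => //=; rewrite pp.
move=> [g _ H]; exists g; apply/infinite_setP => n.
have [p _ /= /andP[pp lp]] := H n Logic.I.
by exists (last g p) => //; exists p.
Qed.

End InfiniteComponents.

(** * Mass of the shells between two balls *)

Section Rates.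
Variables (b : nat) (R : realType) (alpha : R).
Hypotheses (b_ge2 : (2 <= b)%N) (b_lt_alpha : b%:R < alpha).

Let r := b%:R / alpha.

Lemma b_gt0 : 0 < b%:R :> R.
Proof. by rewrite ltr0n (ltn_trans _ b_ge2). Qed.

Lemma alpha_gt0 : 0 < alpha.
Proof. exact: lt_trans b_gt0 b_lt_alpha. Qed.

Lemma ratio_gt0 : 0 < b%:R / alpha.
Proof. by rewrite divr_gt0 ?b_gt0 ?alpha_gt0. Qed.

Lemma ratio_lt1 : b%:R / alpha < 1.
Proof. by rewrite ltr_pdivrMr ?alpha_gt0 // mul1r. Qed.

Lemma mu_pow_gt0 (y : dsum b) : 0 < mu_pow alpha y.
Proof. by rewrite invr_gt0 exprn_gt0 // alpha_gt0. Qed.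

(** The sphere of radius [l + 1] has at most [b ^ (l + 1)] points, each of mass [alpha ^- (l + 1)],
    hence mass at most [r ^ (l + 1) <= r ^ l]. The factor [1 - r] makes the bounds telescope. *)
Lemma shell_mass_le m l : (m <= l)%N ->
  (1 - r) * \sum_(h <- (ellball b l `\` ellball b m)%fset) mu_pow alpha h
    <= r ^+ m - r ^+ l.
Proof.
have r0 := ratio_gt0; have r1 := ratio_lt1.
elim: l => [|l IH].
  by rewrite leqn0 => /eqP ->; rewrite fsetDv big_seq_fset0 mulr0 subrr.
rewrite leq_eqVlt => /predU1P[->|].
  by rewrite fsetDv big_seq_fset0 mulr0 subrr.
rewrite ltnS => ml.
rewrite (big_fsetID _ (mem (ellball b l))) /= mulrDr.
have -> : r ^+ m - r ^+ l.+1 = (r ^+ m - r ^+ l) + (r ^+ l - r ^+ l.+1) by ring.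
apply: lerD.
  apply: le_trans (IH ml); apply: ler_wpM2l; first by rewrite subr_ge0 ltW.
  rewrite le_eqVlt; apply/orP; left; apply/eqP/eq_fbigl => h.
  rewrite !inE /= !in_ellball; apply/idP/idP; last by lia.
  by lia.
have -> : r ^+ l - r ^+ l.+1 = (1 - r) * r ^+ l by rewrite mulrBl mul1r exprS.
apply: ler_wpM2l; first by rewrite subr_ge0 ltW.
apply: (@le_trans _ _ (\sum_(h <- ellball b l.+1) alpha ^- l.+1)).
  apply: (@le_trans _ _ (\sum_(h <- [fset x in ellball b l.+1 `\` ellball b m |
      x \notin mem (ellball b l)]%fset) alpha ^- l.+1)).
    rewrite big_seq [leRHS]big_seq; apply: ler_sum => h.
    rewrite !inE /= !in_ellball => hh; rewrite /mu_pow.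
    by rewrite (_ : ell h = l.+1) //; lia.
  rewrite !big_const_seq !count_predT !iter_addr_0 ler_wpMn2l //.
    by rewrite invr_ge0 exprn_ge0 // ltW // alpha_gt0.
  by apply: fsubset_leq_card; apply/fsubsetP => h; rewrite !inE /= => /andP[/andP[]].
rewrite big_const_seq count_predT iter_addr_0 card_block //.
rewrite -mulr_natr mulrC natrX -exprVn -exprMn exprS.
by rewrite ler_piMl ?exprn_ge0 ?ltW.
Qed.

End Rates.

(** * The case of bounded rates *)


Section Subcritical.
Variables (b : nat) (R : realType) (alpha lam : R).
Hypotheses (b_ge2 : (2 <= b)%N) (b_lt_alpha : b%:R < alpha).
Hypotheses (alpha_large : b%:R ^+ 2 <= alpha) (lam_gt0 : 0 < lam).
Variable X : percolation (mu_pow (b := b) alpha) lam.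
Local Notation pr := (pr (perc_prob X)).
Local Notation depends := (depends (@mult _ _ _ _ X)).

Let r := b%:R / alpha.
Let C := (1 - r)^-1.

Let r_gt0 : 0 < r. Proof. exact: ratio_gt0. Qed.
Let r_lt1 : r < 1. Proof. exact: ratio_lt1. Qed.
Let C_gt0 : 0 < C. Proof. by rewrite invr_gt0 subr_gt0. Qed.

Let shell m l := (ellball b l `\` ellball b m)%fset.

Let shell_disjoint n m l : (n <= m)%N -> [disjoint ellball b n & shell m l]%fset.
Proof.
move=> nm; apply/fdisjointP => x; rewrite !inE !in_ellball => xn.
by rewrite (leq_trans xn nm).
Qed.

(** Each of the [b ^ n] points of the ball sees the shell with the same mass, at most [C * r ^ m].
    The total is at most [C * (r * b) ^ n * r ^ (m - n)], and [r * b <= 1] is the assumption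
    [b ^ 2 <= alpha]. *)
Lemma shell_rate_le n m l : (n <= m <= l)%N ->
  \sum_(g <- ellball b n) \sum_(h <- shell m l) mu_pow alpha (h - g)
    <= C * r ^+ (m - n).
Proof.
move=> /andP[nm ml].
have rb : r * b%:R <= 1.
  by rewrite /r mulrAC ler_pdivrMr ?(alpha_gt0 b_ge2 b_lt_alpha) // mul1r -expr2.
rewrite big_seq (eq_bigr (fun=> \sum_(h <- shell m l) mu_pow alpha h)).
  rewrite -big_seq big_const_seq count_predT iter_addr_0 card_block //.
  apply: (@le_trans _ _ (C * r ^+ m *+ b ^ n)).
    apply: ler_wMn2r; rewrite /C -ler_pdivrMl ?invr_gt0 ?subr_gt0 // invrK.
    apply: le_trans (shell_mass_le b_ge2 b_lt_alpha ml) _.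
    by rewrite gerBl exprn_ge0 // ltW.
  rewrite -mulr_natr -mulrA ler_pM2l // -(subnK nm) exprD addnK -mulrA.
  rewrite ler_piMr ?exprn_ge0 ?(ltW r_gt0) // natrX -exprMn.
  by rewrite exprn_ile1 // mulr_ge0 // ltW.
move=> g gn; rewrite big_seq [RHS]big_seq; apply: eq_bigr => h.
rewrite !inE => /andP[hm _]; rewrite /mu_pow.
by rewrite (ellB (fsubsetP (ellball_sub b nm) _ gn) hm).
Qed.

(** The inner radius [m] separates near from far edges; the outer radius [l] keeps the set of edges
    finite until a monotone limit is taken. *)
Definition escapes n m l : set (perc_space X) :=
  ~` unlinked X (ellball b n) (shell m l).

Lemma measurable_escapes n m l : measurable (escapes n m l).
Proof. exact/measurableC/(measurable_unlinked X (edge0 b)). Qed.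

Lemma escapesS n m l m' l' : (m' <= m)%N -> (l <= l')%N ->
  escapes n m l `<=` escapes n m' l'.
Proof.
move=> mm ll; apply: subsetC => w H g h gn hml; apply: H => //.
by move: hml; rewrite !inE !in_ellball; lia.
Qed.

Let pr_escapes n m l : (n <= m)%N ->
  pr (escapes n m l) = 1 - expR (- (lam *
    \sum_(g <- ellball b n) \sum_(h <- shell m l) mu_pow alpha (h - g))).
Proof.
move=> nm; rewrite prC; last exact: (measurable_unlinked X (edge0 b)).
rewrite (pr_unlinked X (edge0 b)) //; last exact: shell_disjoint.
  by move=> g; apply/ltW/mu_pow_gt0.
exact: ltW.
Qed.

(** The inequality [1 - exp (- x) <= x] applied to the rate bound. *)
Lemma pr_escapes_far n m l : (n <= m <= l)%N ->
  pr (escapes n m l) <= lam * C * r ^+ (m - n).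
Proof.
move=> nml; rewrite pr_escapes; last by case/andP: nml.
rewrite lerBlDr -lerBlDl; apply: le_trans (expR_ge1Dx _).
by rewrite lerB // -mulrA ler_pM2l //; exact: shell_rate_le.
Qed.

Let c := 1 - expR (- (lam * C)).

Let c_ge0 : 0 <= c.
Proof. by rewrite subr_ge0 -expR0 ler_expR oppr_le0 mulr_ge0 ?ltW. Qed.

Let c_lt1 : c < 1.
Proof. by rewrite ltrBlDr ltrDl expR_gt0. Qed.

Lemma pr_escapes_near n l : (n <= l)%N -> pr (escapes n n l) <= c.
Proof.
move=> nl; rewrite pr_escapes // lerB // ler_expR lerN2 ler_pM2l //.
by apply: le_trans (shell_rate_le _) _; rewrite ?leqnn // subnn expr0 mulr1.
Qed.

Section Chain.
Variables n0 L : nat.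
Let step j := (n0 + L * j)%N.

Let stepS j : (step j <= step j.+1)%N.
Proof. by rewrite /step leq_add2l leq_mul2l leqnSn orbT. Qed.

(** Each ball is only required to reach the shell up to the next radius: these events concern
    disjoint sets of edges. *)
Fixpoint chain M : set (perc_space X) :=
  if M is M'.+1 then chain M' `&` escapes (step M') (step M') (step M)
  else setT.

Lemma chainP M w :
  chain M w <-> forall j, (j < M)%N -> escapes (step j) (step j) (step j.+1) w.
Proof.
elim: M => [|M IH] //=; split.
  move=> [/IH H e] j; rewrite ltnS leq_eqVlt => /predU1P[->//|]; exact: H.
move=> H; split; last exact: H.
by apply/IH => j jM; apply: H; rewrite ltnS ltnW.
Qed.

Lemma depends_chain M : depends (edges_in (ellball b (step M))) (chain M).
Proof.
elim: M => [|M IH] /=; first by move=> w w'.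
have sM := ellball_sub b (stepS M).
apply: depends_setI; first exact: dependsW (edges_in_sub sM) IH.
apply: depends_setC; apply: depends_unlinked_in => //; first exact: edge0.
exact: fsubsetDl.
Qed.

(** [chain M] depends on the edges inside the ball of radius [step M], and the next event on edges
    that leave this ball. *)
Lemma pr_chain_le M : pr (chain M) <= c ^+ M.
Proof.
elim: M => [|M IH] /=; first by rewrite expr0 pr_le1.
rewrite exprSr; apply: (@le_trans _ _ (pr (chain M) * c)); last first.
  exact: ler_wpM2r.
apply: (@pr_le_indep _ _ _ _ _ _ (@mult_indep _ _ _ _ X)
  (edges_in (ellball b (step M)))
  (edges_between (edge0 b) (ellball b (step M)) (shell (step M) (step M.+1)))).
- exact/edges_between_disjoint/shell_disjoint.
- exact: depends_chain.
- by apply: depends_setC; exact: depends_unlinked.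
- exact: pr_escapes_near.
Qed.

Definition never_isolated_upto M l : set (perc_space X) :=
  [set w | forall j, (j < M)%N -> escapes (step j) (step j) l w].

(** Either the whole chain occurs, or one of the [M] balls has an edge that jumps over the next
    ball, a distance of at least [L] in radius. *)
Lemma pr_never_isolated_upto M l : (step M <= l)%N ->
  pr (never_isolated_upto M l) <= c ^+ M + M%:R * (lam * C * r ^+ L).
Proof.
move=> Ml.
have mno : measurable (never_isolated_upto M l).
  rewrite (_ : never_isolated_upto M l =
      \bigcap_(j in `I_M) escapes (step j) (step j) l) //.
  by apply: fin_bigcap_measurable => // j _; exact: measurable_escapes.
have mc : measurable (chain M) by exact: measurable_depends (@depends_chain M).
pose far j := escapes (step j) (step j.+1) l.
have mf j : measurable (far j) by exact: measurable_escapes.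
have mF : measurable [set w | exists2 j, j \in iota 0 M & far j w].
  exact: measurable_has.
apply: (@le_trans _ _
    (pr (chain M `|` [set w | exists2 j, j \in iota 0 M & far j w]))).
  apply: le_pr => //; first exact: measurableU.
  move=> w H; have [[j jM fj]|nf] :=
      pselect (exists2 j, j \in iota 0 M & far j w); first by right; exists j.
  left; apply/chainP => j jM; have := H j jM; rewrite /escapes /=.
  apply: contra_not => u g h gn hl; apply: contrapT => /negP/negPn jgh.
  (* The edge from [g] to [h] ends either in the next shell, as the chain requires, or beyond it,
     which [nf] excludes. *)
  have [hj|hj] := boolP (h \in shell (step j) (step j.+1)).
    by have := u _ _ gn hj; rewrite jgh.
  apply: nf; exists j; first by rewrite mem_iota.
  have hf : h \in shell (step j.+1) l.
    by move: hl hj; rewrite !inE !in_ellball; lia.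
  by move=> /(_ g h gn hf); rewrite jgh.
apply: le_trans (pr_leU _ mc mF) _; apply: lerD; first exact: pr_chain_le.
apply: le_trans (pr_le_has _ _ mf) _.
rewrite mulr_natl -[X in _ *+ X](size_iota 0) -count_predT -iter_addr_0 -big_const_seq.
rewrite big_seq [leRHS]big_seq; apply: ler_sum => j; rewrite mem_iota => jM.
rewrite (_ : L = step j.+1 - step j)%N; last by rewrite /step; lia.
apply: pr_escapes_far; rewrite stepS /=; apply: leq_trans Ml.
by rewrite leq_add2l leq_mul2l; move: jM; case: (L == 0)%N => //=; lia.
Qed.

End Chain.

Definition never_isolated n0 : set (perc_space X) :=
  [set w | forall n, (n0 <= n)%N -> exists l, escapes n n l w].

Lemma measurable_never_isolated n0 : measurable (never_isolated n0).
Proof.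
rewrite (_ : never_isolated n0 =
    \bigcap_(n in [set n | (n0 <= n)%N]) \bigcup_l escapes n n l).
  apply: bigcap_measurable => [|n _]; first by exists n0 => /=.
  by apply: bigcupT_measurable => l; exact: measurable_escapes.
apply/seteqP; split=> w /= H n n0n.
  by have [l el] := H n n0n; exists l.
by have [l _ el] := H n n0n; exists l.
Qed.

Lemma pr_never_isolated_le n0 L M :
  pr (never_isolated n0) <= c ^+ M + M%:R * (lam * C * r ^+ L).
Proof.
pose top := (n0 + L * M)%N.
pose F l := never_isolated_upto n0 L M (top + l).
have FE l : F l = \bigcap_(j in `I_M) escapes (n0 + L * j) (n0 + L * j) (top + l).
  by [].
have mF l : measurable (F l).
  by rewrite FE; apply: fin_bigcap_measurable => // j _; exact: measurable_escapes.
have ndF : nondecreasing_seq F.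
  move=> l l' ll'; apply/subsetPset => w H j jM.
  by apply: (escapesS _ _ (H j jM)); rewrite ?leq_add2l.
apply: (@le_trans _ _ (pr (\bigcup_l F l))); last first.
  apply: pr_bigcup_nondecreasing => // l.
  by apply: pr_never_isolated_upto; exact: leq_addr.
apply: le_pr; [exact: measurable_never_isolated|exact: bigcupT_measurable|].
move=> w H.
have [f Hf] : {f : nat -> nat & forall j,
    escapes (n0 + L * j) (n0 + L * j) (f j) w}.
  by apply: (@choice _ _ (fun j l => escapes _ _ l w)) => j; apply: H; lia.
(* Only [M] balls matter, so a single outer radius serves all of them. *)
exists (\max_(j < M) f j)%N => // j jM.
apply: (escapesS _ _ (Hf j)) => //; apply: leq_trans (leq_addl _ _).
exact: (leq_bigmax (Ordinal jM)).
Qed.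

Lemma pr_never_isolated n0 : pr (never_isolated n0) = 0.
Proof.
apply/eqP; rewrite eq_le pr_ge0 andbT.
have geo x y : 0 <= x < 1 -> (fun n => y * x ^+ n) @ \oo --> (0 : R).
  move=> /andP[x0 x1]; rewrite -[X in _ --> X](mulr0 y); apply: cvgMr.
  by apply: cvg_expr; rewrite ger0_norm.
(* First [L] tends to infinity with [M] fixed, which removes the far edges; then [M] does. *)
have step1 M : pr (never_isolated n0) <= c ^+ M.
  have cv : (fun L => c ^+ M + M%:R * (lam * C) * r ^+ L) @ \oo --> c ^+ M.
    rewrite -[X in _ --> X]addr0; apply: cvgD; first exact: cvg_cst.
    by apply: geo; rewrite r_lt1 ltW.
  rewrite -(cvg_lim _ cv) //; apply: limr_ge; first by apply/cvg_ex; eexists; exact: cv.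
  by apply: nearW => L; rewrite -[X in _ + X]mulrA; exact: pr_never_isolated_le.
have cv : (fun M => 1 * c ^+ M) @ \oo --> (0 : R) by apply: geo; rewrite c_ge0.
rewrite -(cvg_lim _ cv) //; apply: limr_ge; first by apply/cvg_ex; eexists; exact: cv.
by apply: nearW => M; rewrite mul1r.
Qed.

(** An infinite component through [g] leaves every ball that contains [g], so [n0] can be
    [ell g]. *)
Lemma infinite_component_never_isolated :
  infinite_component_event X `<=` \bigcup_n0 never_isolated n0.
Proof.
move=> w [g /infinite_setP H]; exists (ell g) => // n gn.
have [_ [p pp <-] hn] := H n.
have gB : g \in ellball b n by rewrite in_ellball.
have [x [y [xn yn xy]]] := path_exit (S := mem (ellball b n)) pp gB hn.
have ys : y \in shell n (ell y).
  by rewrite in_fsetD yn in_ellball /=.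
by exists (ell y) => /(_ x y xn ys); rewrite xy.
Qed.

Lemma no_infinite_component : perc_prob X (infinite_component_event X) = 0%E.
Proof.
have mI := measurable_infinite_component X.
rewrite prE //; congr EFin; apply/eqP; rewrite eq_le pr_ge0 andbT -lee_fin -prE //.
have mN n : measurable (never_isolated n) by exact: measurable_never_isolated.
have N0 : perc_prob X (\bigcup_n never_isolated n) = 0%E.
  apply/negligibleP; first exact: bigcupT_measurable.
  apply: negligible_bigcup => n; apply/negligibleP => //.
  by have := prE (perc_prob X) (mN n); rewrite pr_never_isolated.
apply: (@le_trans _ _ (perc_prob X (\bigcup_n never_isolated n))); last by rewrite N0.
apply: le_measure; rewrite ?inE //.
  exact: bigcupT_measurable.
exact: infinite_component_never_isolated.
Qed.

End Subcritical.

(** * Hierarchical clusters *)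


Lemma card_bigfcup_disjoint (I : eqType) (T : choiceType) (s : seq I)
    (F : I -> {fset T}) : uniq s ->
  {in s &, forall i j, i != j -> [disjoint F i & F j]%fset} ->
  #|` \bigcup_(i <- s) F i|%fset = (\sum_(i <- s) #|` F i|)%N.
Proof.
elim: s => [|i s IH] /= us dF; first by rewrite !big_nil cardfs0.
move: us => /andP[is_ us]; rewrite !big_cons -IH // => [|j l js ls].
  rewrite cardfsU (_ : _ `&` _ = fset0)%fset ?cardfs0 ?subn0 //.
  apply/eqP/fdisjointP => x xi; apply/negP => /bigfcupP[j].
  rewrite andbT => js xj.
  have ij : i != j by apply: contraNneq is_ => ->.
  have := dF i j (mem_head _ _); rewrite inE js orbT => /(_ isT ij)/fdisjointP.
  by move=> /(_ x xi); rewrite xj.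
by apply: dF; rewrite inE ?js ?ls orbT.
Qed.

Section Clusters.
Variables (b k : nat).
Hypothesis b_ge2 : (2 <= b)%N.
Hypothesis k_gt0 : (0 < k)%N.
Implicit Types (a : rel (dsum b)) (n : nat) (x g h : dsum b).

Let N := (b ^ k)%N.

Definition linked a (A B : {fset dsum b}) := has (fun g => has (a g) B) A.

(** Two empty clusters are incompatible, and two non-empty ones must be linked. Pairwise
    compatibility thus says both that at most one subball is bad and that the good ones are
    joined. *)
Definition compatible a (A B : {fset dsum b}) :=
  linked a A B || ((A == fset0) != (B == fset0)).

Definition shifts n := block b (k * n) k.

(* The cluster is empty when the ball is bad: a ball is good when at most one
   of its [b ^ k] subballs is bad and the clusters of the good ones are
   pairwise linked. *)
Fixpoint hcluster a n x : {fset dsum b} :=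
  if n is n'.+1 then
    if all (fun z => all (fun z' => (z == z') ||
         compatible a (hcluster a n' (x + z)) (hcluster a n' (x + z')))
         (shifts n')) (shifts n')
    then (\bigcup_(z <- shifts n') hcluster a n' (x + z)%R)%fset
    else fset0
  else [fset x]%fset.

Definition cball n x := [fset (x + v)%R | v in ellball b (k * n)]%fset.

Lemma in_cball n x y : (y \in cball n x) = (y - x \in ellball b (k * n)).
Proof.
apply/imfsetP/idP => [[v /= vn ->]|yx]; first by rewrite addrAC subrr add0r.
by exists (y - x); rewrite //= addrCA subrr addr0.
Qed.

Lemma shifts_ellball n z : z \in shifts n -> z \in ellball b (k * n.+1).
Proof. by move/(fsubsetP (block_sub_ball _ _ _)); rewrite mulnS addnC. Qed.

Lemma cball_shift_sub n x z : z \in shifts n ->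
  (cball n (x + z)%R `<=` cball n.+1 x)%fset.
Proof.
move=> /shifts_ellball zn; apply/fsubsetP => y; rewrite !in_cball => yn.
have -> : y - x = (y - (x + z)) + z by rewrite opprD addrA subrK.
apply: blockD => //; apply: (fsubsetP (ellball_sub _ _)) yn.
by rewrite leq_mul2l leqnSn orbT.
Qed.

Lemma cball_shift_disjoint n x z z' : z \in shifts n -> z' \in shifts n ->
  z != z' -> [disjoint cball n (x + z)%R & cball n (x + z')%R]%fset.
Proof.
move=> zn z'n zz'; apply/fdisjointP => y; rewrite !in_cball => yz.
apply/negP => yz'; case/eqP: zz'; apply: (block_ball_inj zn z'n).
have -> : z - z' = (y - (x + z')) - (y - (x + z)).
  by rewrite opprB [RHS]addrC addrA subrK opprD addrACA subrr add0r.
exact: blockB.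
Qed.

Lemma cball_shift_sub_ell n x z z' g h : z \in shifts n -> z' \in shifts n ->
  g \in cball n (x + z) -> h \in cball n (x + z') ->
  (ell (h - g)%R <= k * n.+1)%N.
Proof.
move=> zn z'n /(fsubsetP (cball_shift_sub _ zn)); rewrite in_cball => gx.
move=> /(fsubsetP (cball_shift_sub _ z'n)); rewrite in_cball => hx.
have -> : h - g = (h - x) - (g - x) by rewrite opprB addrA subrK.
by rewrite -in_ellball; exact: blockB.
Qed.

Lemma cluster_sub a n x : (hcluster a n x `<=` cball n x)%fset.
Proof.
elim: n x => [|n IH] x /=.
  by apply/fsubsetP => y; rewrite inE in_cball => /eqP ->; rewrite subrr block0.
case: ifP => _; last exact: fsub0set.
apply/bigfcupsP => z zn _.
exact: fsubset_trans (IH _) (cball_shift_sub _ zn).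
Qed.

Lemma eq_in_linked a a' (A B : {fset dsum b}) : {in A & B, a =2 a'} ->
  linked a A B = linked a' A B.
Proof.
move=> e; apply: eq_in_has => g gA; apply: eq_in_has => h hB; exact: e.
Qed.

(** Locality of the construction, which makes the clusters of disjoint balls independent. *)
Lemma eq_in_cluster a a' n x : {in cball n x &, a =2 a'} ->
  hcluster a n x = hcluster a' n x.
Proof.
elim: n x => [//|n IH] x e /=.
have cE z : z \in shifts n -> hcluster a n (x + z) = hcluster a' n (x + z).
  move=> /(cball_shift_sub x)/fsubsetP zn; apply: IH => g h gz hz.
  by apply: e; exact: zn.
congr (if _ then _ else _).
  apply: eq_in_all => z zn; apply: eq_in_all => z' z'n; congr (_ || _).
  rewrite /compatible !cE //; congr (_ || _); apply: eq_in_linked => g h.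
  move=> /(fsubsetP (cluster_sub _ _ _))/(fsubsetP (cball_shift_sub _ zn)) gx.
  move=> /(fsubsetP (cluster_sub _ _ _))/(fsubsetP (cball_shift_sub _ z'n)) hx.
  exact: e.
by apply: eq_big_seq => z zn; rewrite cE.
Qed.

Lemma card_shifts n : #|` shifts n| = N.
Proof. exact: card_block. Qed.

Let N_ge2 : (2 <= N)%N.
Proof. by rewrite /N (leq_trans b_ge2) // -{1}(expn1 b) leq_pexp2l ?(ltnW b_ge2). Qed.

Lemma shifts_two n : exists z z', [/\ z \in shifts n, z' \in shifts n & z != z'].
Proof.
have : shifts n != fset0 by rewrite -cardfs_gt0 card_shifts; lia.
case/fset0Pn => z zn; exists z.
have : (shifts n `\ z)%fset != fset0.
  rewrite -cardfs_gt0; have := cardfsD1 z (shifts n).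
  by rewrite zn card_shifts; lia.
by case/fset0Pn => z'; rewrite !inE eq_sym => /andP[? ?]; exists z'.
Qed.

Lemma cluster_eq0 a n x : hcluster a n.+1 x = fset0 ->
  exists z z', [/\ z \in shifts n, z' \in shifts n, z != z' &
    (hcluster a n (x + z) = fset0 /\ hcluster a n (x + z') = fset0) \/
    [/\ hcluster a n (x + z) != fset0, hcluster a n (x + z') != fset0 &
        ~~ linked a (hcluster a n (x + z)) (hcluster a n (x + z'))]].
Proof.
(* If the test passes and the union is empty, all subclusters are empty and any two shifts serve;
   otherwise the failing pair serves. *)
move=> /=; case: ifPn => [_ U0|/allPn[z zn /allPn[z' z'n]]].
  have F0 z : z \in shifts n -> hcluster a n (x + z) = fset0.
    move=> zn; apply/eqP; rewrite -fsubset0 -U0.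
    by apply/fsubsetP => y yz; apply/bigfcupP; exists z; rewrite // zn.
  have [z [z' [zn z'n zz']]] := shifts_two n.
  by exists z, z'; split=> //; left; rewrite !F0.
rewrite negb_or => /andP[zz']; rewrite /compatible negb_or negbK => /andP[nl e0] _.
exists z, z'; split=> //; move: e0 nl.
have [->|z0] := eqVneq (hcluster a n (x + z)) fset0.
  by move=> /eqP/esym/eqP ->; left.
by move=> /eqP/esym/negbT z'0 nl; right.
Qed.

Lemma cluster_neq0 a n x : hcluster a n.+1 x != fset0 ->
  hcluster a n.+1 x = (\bigcup_(z <- shifts n) hcluster a n (x + z)%R)%fset /\
  {in shifts n &, forall z z', z != z' ->
     compatible a (hcluster a n (x + z)) (hcluster a n (x + z'))}.
Proof.
move=> /=; case: ifPn => [/allP H _|_]; last by rewrite eqxx.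
split=> // z z' zn z'n zz'.
by have /allP/(_ z' z'n) := H z zn; rewrite (negbTE zz').
Qed.

(** Subclusters lie in disjoint subballs, and at least [N - 1] of them are non-empty. *)
Lemma card_cluster_ge a n x : hcluster a n x != fset0 ->
  ((N - 1) ^ n <= #|` hcluster a n x|)%N.
Proof.
elim: n x => [|n IH] x c0; first by rewrite expn0 cardfs_gt0.
have [-> comp] := cluster_neq0 c0.
rewrite card_bigfcup_disjoint ?fset_uniq //; last first.
  move=> z z' zn z'n zz'.
  apply: fdisjointWl (cluster_sub _ _ _) _.
  by apply: fdisjointWr (cluster_sub _ _ _) _; exact: cball_shift_disjoint.
have big z0 : (forall z, z \in (shifts n `\ z0)%fset ->
    hcluster a n (x + z) != fset0) -> z0 \in shifts n ->
  ((N - 1) ^ n.+1 <= \sum_(z <- shifts n) #|` hcluster a n (x + z)%R|)%N.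
  move=> H z0n; rewrite (big_fsetD1 z0) //=.
  apply: leq_trans (leq_addl _ _).
  apply: (@leq_trans (\sum_(z <- (shifts n `\ z0)%fset) (N - 1) ^ n)%N).
    rewrite big_const_seq count_predT iter_addn_0 expnSr leq_mul2l.
    apply/orP; right; have := cardfsD1 z0 (shifts n).
    by rewrite z0n card_shifts; lia.
  by rewrite big_seq [leqRHS]big_seq; apply: leq_sum => z /H; exact: IH.
(* The shift left out of the count is the empty one if it exists, and arbitrary otherwise. *)
have [/allP nz|/allPn[z0 z0n]] :=
    boolP (all (fun z => hcluster a n (x + z) != fset0) (shifts n)).
  have [z0 [_ [z0n _ _]]] := shifts_two n.
  by apply: (big z0) => // z; rewrite !inE => /andP[_]; exact: nz.
rewrite negbK => /eqP e0; apply: (big z0) => // z; rewrite !inE => /andP[zz0 zn].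
have := comp z z0 zn z0n zz0; rewrite /compatible e0 eqxx.
rewrite (_ : linked _ _ _ = false) /=; first by case: (hcluster a n (x + z) == fset0).
by apply/hasPn => g _; apply/hasPn.
Qed.

Lemma cluster_connected a n x : {in hcluster a n x &, forall g h,
  exists2 p, path a g p & last g p = h}.
Proof.
elim: n x => [|n IH] x g h.
  by rewrite !inE => /eqP -> /eqP ->; exists [::].
move=> gx hx; have c0 : hcluster a n.+1 x != fset0.
  by apply/fset0Pn; exists g.
have [cE comp] := cluster_neq0 c0; move: gx hx; rewrite cE.
move=> /bigfcupP[z /andP[zn _] gz] /bigfcupP[z' /andP[z'n _] hz'].
have [ezz'|zz'] := eqVneq z z'; first by apply: IH gz _; rewrite ezz'.
have := comp z z' zn z'n zz'; rewrite /compatible.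
have -> : hcluster a n (x + z) == fset0 = false by apply/negbTE/fset0Pn; exists g.
have -> : hcluster a n (x + z') == fset0 = false by apply/negbTE/fset0Pn; exists h.
rewrite orbF => /hasP[g1 g1z /hasP[h1 h1z' gh1]].
have [p pp pl] := IH _ _ _ gz g1z; have [q qq ql] := IH _ _ _ h1z' hz'.
by exists (p ++ h1 :: q); rewrite ?cat_path ?last_cat /= ?pp ?pl ?gh1.
Qed.

(** The shift [0] makes the cluster of each ball around 0 part of the next one, starting from the
    singleton of 0. *)
Lemma cluster0_in a n : (forall m, hcluster a m 0 != fset0) ->
  0 \in hcluster a n 0.
Proof.
move=> nz; elim: n => [|n IH]; first by rewrite inE.
have [-> _] := cluster_neq0 (nz n.+1).
by apply/bigfcupP; exists 0; rewrite ?addr0 // block0.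
Qed.

End Clusters.


(** * Renormalisation and percolation for large [lam] *)

Section Supercritical.
Variables (b k : nat) (R : realType) (alpha lam : R).
Hypotheses (b_ge2 : (2 <= b)%N) (k_gt0 : (0 < k)%N) (b_lt_alpha : b%:R < alpha).
Let N := (b ^ k)%N.
(** From one level to the next, the guaranteed number of pairs of cluster points grows by
    [(N - 1) ^ 2] and the least mass of a pair drops by [alpha ^ k]: the bound on the linking rate
    at least doubles. *)
Hypothesis growth : 2 * alpha ^+ k <= ((N - 1) ^ 2)%:R.
Hypothesis lam_large : 16 * N%:R ^+ 4 * alpha ^+ k <= lam.
Variable X : percolation (mu_pow (b := b) alpha) lam.
Local Notation pr := (pr (perc_prob X)).
Local Notation depends := (depends (@mult _ _ _ _ X)).
Implicit Types (x z : dsum b) (n : nat).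

Let F n x (w : perc_space X) := hcluster k (joined w) n x.

Let alpha_gt0' : 0 < alpha. Proof. exact: alpha_gt0 b_ge2 b_lt_alpha. Qed.

Let N_gt0 : 0 < N%:R :> R.
Proof. by rewrite ltr0n expn_gt0 (ltnW b_ge2). Qed.

Let lam_gt0 : 0 < lam.
Proof.
apply: lt_le_trans lam_large; apply: mulr_gt0; last exact: exprn_gt0.
by apply: mulr_gt0; rewrite ?ltr0n // exprn_gt0.
Qed.

Lemma cfg_cluster (A : {fset dsum b}) n x w w' : (cball k n x `<=` A)%fset ->
  cfg (@mult _ _ _ _ X) (edges_in A) w = cfg (@mult _ _ _ _ X) (edges_in A) w' ->
  F n x w = F n x w'.
Proof.
move=> /fsubsetP sA /(joined_edges_in (edge0 b)) e; apply: eq_in_cluster => g h gx hx.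
by apply: e; exact: sA.
Qed.

Definition bad n x : set (perc_space X) := [set w | F n x w = fset0].

Lemma depends_bad n x : depends (edges_in (cball k n x)) (bad n x).
Proof. by move=> w w' /(cfg_cluster (fsubset_refl _)); rewrite /bad /= => ->. Qed.

Lemma measurable_bad n x : measurable (bad n x).
Proof. exact: measurable_depends (@depends_bad n x). Qed.

Definition unlinked_clusters n x y : set (perc_space X) :=
  [set w | [/\ F n x w != fset0, F n y w != fset0 &
               ~~ linked (joined w) (F n x w) (F n y w)]].

Lemma depends_unlinked_clusters (A : {fset dsum b}) n x y :
  (cball k n x `<=` A)%fset -> (cball k n y `<=` A)%fset ->
  depends (edges_in A) (unlinked_clusters n x y).
Proof.
move=> xA yA w w' e; rewrite /unlinked_clusters /= -!(cfg_cluster _ e) // => -[? ?].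
rewrite (@eq_in_linked _ _ (joined w')) //.
move=> g h /(fsubsetP (cluster_sub _ _ _ _))/(fsubsetP xA) gA.
move=> /(fsubsetP (cluster_sub _ _ _ _))/(fsubsetP yA) hA.
exact: (joined_edges_in (edge0 b) e).
Qed.

Lemma subset_bad n x : bad n.+1 x `<=` [set w |
  exists2 p, p \in [seq (z, z') | z <- shifts b k n, z' <- shifts b k n] &
    (p.1 != p.2) /\
    ((bad n (x + p.1) `&` bad n (x + p.2)) `|`
      unlinked_clusters n (x + p.1) (x + p.2)) w].
Proof.
move=> w /(cluster_eq0 b_ge2 k_gt0)[z [z' [zn z'n zz' H]]].
by exists (z, z'); [exact: allpairs_f|split].
Qed.

Let eps n := (16 * N%:R ^+ 4 * 2 ^+ n)^-1 : R.

(** Given the edges inside the two balls, the clusters are fixed sets and the edges between them are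
    still independent. The rate between them is at least [Y = 16 * N ^ 4 * 2 ^ n], and
    [exp (- Y) <= 1 / Y = eps n]. *)
Lemma pr_unlinked_clusters n x z z' :
  z \in shifts b k n -> z' \in shifts b k n -> z != z' ->
  pr (unlinked_clusters n (x + z) (x + z')) <= eps n.
Proof.
move=> zn z'n zz'.
have dB := cball_shift_disjoint x zn z'n zz'.
set B := cball k n (x + z) in dB *; set B' := cball k n (x + z') in dB *.
pose J := (edges_in B `|` edges_in B')%fset.
pose A := ~` bad n (x + z) `&` ~` bad n (x + z').
have dA : depends J A.
  by apply: depends_setI; apply: depends_setC;
    [apply: dependsW (fsubsetUl _ _) _|apply: dependsW (fsubsetUr _ _) _];
    exact: depends_bad.
have mU : measurable (unlinked_clusters n (x + z) (x + z')).
  by apply: measurable_depends; apply: (@depends_unlinked_clusters (B `|` B')%fset);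
    rewrite ?fsubsetUl ?fsubsetUr.
apply: (@le_trans _ _ (pr A * eps n)); last first.
  have eps_ge0 : 0 <= eps n by rewrite invr_ge0 !mulr_ge0 ?exprn_ge0 // ltW.
  by rewrite ler_piMl // pr_le1 //; exact: measurable_depends dA.
apply: (@pr_le_cond _ _ _ _ _ _ (@mult_indep _ _ _ _ X) J
  (edges_between (edge0 b) B B')) => //.
- rewrite /J fdisjointUX edges_between_disjoint //=.
  exact: edges_between_disjointr.
- by move=> w [/eqP ? /eqP ? _].
move=> w0 [/eqP nz /eqP nz'].
(* The clusters are frozen at their values in [w0], so that this event involves only the edges
   between the balls. *)
exists (unlinked X (F n (x + z) w0) (F n (x + z') w0)); last first.
  move=> w [[_ _ nl] e] g h.
  rewrite -(cfg_cluster (fsubset_refl _) (cfgW (fsubsetUl _ _) e)).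
  rewrite -(cfg_cluster (fsubset_refl _) (cfgW (fsubsetUr _ _) e)).
  by move: nl => /hasPn nl /nl /hasPn H /H.
split; first by apply: depends_unlinked; exact: cluster_sub.
rewrite (pr_unlinked X (edge0 b)) //; last first.
- apply: fdisjointWl (cluster_sub _ _ _ _) _.
  by apply: fdisjointWr (cluster_sub _ _ _ _) dB.
- exact: ltW.
- by move=> g; apply/ltW/mu_pow_gt0.
set C := F n (x + z) w0; set C' := F n (x + z') w0.
(* Both clusters lie in one ball of radius [k * n.+1], which bounds the mass of each pair from
   below. *)
have mass : alpha ^- (k * n.+1) * (((N - 1) ^ n)%:R * ((N - 1) ^ n)%:R) <=
    \sum_(g <- C) \sum_(h <- C') mu_pow alpha (h - g).
  apply: (@le_trans _ _ (\sum_(g <- C) \sum_(h <- C') alpha ^- (k * n.+1))).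
    rewrite !big_const_seq !count_predT !iter_addr_0 -mulrnA -[leRHS]mulr_natr.
    rewrite ler_pM2l ?invr_gt0 ?exprn_gt0 // -natrM ler_nat mulnC.
    by apply: leq_mul; exact: card_cluster_ge.
  rewrite big_seq [leRHS]big_seq; apply: ler_sum => g gC.
  rewrite big_seq [leRHS]big_seq; apply: ler_sum => h hC.
  rewrite /mu_pow lef_pV2 ?posrE ?exprn_gt0 // ler_weXn2l //.
    by apply: le_trans (ltW b_lt_alpha); rewrite ler1n (ltnW b_ge2).
  apply: (cball_shift_sub_ell (x := x) zn z'n).
    exact: (fsubsetP (cluster_sub _ _ _ _) _ gC).
  exact: (fsubsetP (cluster_sub _ _ _ _) _ hC).
pose Y : R := 16 * N%:R ^+ 4 * 2 ^+ n.
have Y_gt0 : 0 < Y by rewrite !mulr_gt0 ?exprn_gt0.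
apply: (@le_trans _ _ (expR (- Y))); last first.
  rewrite /eps -/Y expRN lef_pV2 ?posrE ?expR_gt0 //.
  by apply: le_trans (expR_ge1Dx _); rewrite lerDr.
rewrite ler_expR lerN2; apply: le_trans (ler_wpM2l (ltW lam_gt0) mass).
have -> : Y = (16 * N%:R ^+ 4 * alpha ^+ k) *
    (alpha ^- (k * n.+1) * (2 * alpha ^+ k) ^+ n).
  rewrite mulnS exprD exprMn exprM /Y.
  by field; rewrite !expf_neq0 ?gt_eqF.
apply: ler_pM => //.
- by rewrite !mulr_ge0 ?exprn_ge0 // ltW.
- by rewrite mulr_ge0 ?invr_ge0 ?exprn_ge0 ?mulr_ge0 ?exprn_ge0 // ltW.
rewrite ler_pM2l ?invr_gt0 ?exprn_gt0 // -natrM -expnD addnn -mul2n expnM natrX.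
apply: lerXn2r => //; rewrite nnegrE ?mulr_ge0 ?exprn_ge0 // ltW //.
Qed.

(** Chosen so that [N ^ 2 * (q n ^ 2 + eps n) <= q n.+1], with a sum over [n] of at most 1/2. *)
Let q n := (4 * N%:R ^+ 2 * 2 ^+ n)^-1 : R.

Lemma pr_bad_le n x : pr (bad n x) <= q n.
Proof.
elim: n x => [|n IH] x.
  rewrite (_ : bad 0 x = set0) ?pr_set0 ?invr_ge0 ?mulr_ge0 ?exprn_ge0 //.
  apply/seteqP; split=> w //; rewrite /bad /= => /fsetP/(_ x).
  by rewrite !inE eqxx.
set s := [seq (z, z') | z <- shifts b k n, z' <- shifts b k n].
pose A (p : dsum b * dsum b) : set (perc_space X) := [set w | (p.1 != p.2) /\
    ((bad n (x + p.1) `&` bad n (x + p.2)) `|`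
      unlinked_clusters n (x + p.1) (x + p.2)) w].
pose E p := (bad n (x + p.1) `&` bad n (x + p.2)) `|`
      unlinked_clusters n (x + p.1) (x + p.2).
have mB := measurable_bad.
have mU y y' : measurable (unlinked_clusters n y y').
  by apply: measurable_depends;
    apply: (@depends_unlinked_clusters (cball k n y `|` cball k n y')%fset);
    rewrite ?fsubsetUl ?fsubsetUr.
have mE p : measurable (E p).
  by apply: measurableU => //; exact: measurableI.
(* Diagonal pairs must be void: a ball met with itself would contribute [q n] and not its square. *)
have AE p : A p = if p.1 == p.2 then set0 else E p.
  by rewrite /A; apply/seteqP; split=> w; case: eqP => // e []//; rewrite ?e ?eqxx.
have mA p : measurable (A p) by rewrite AE; case: ifP.
apply: (@le_trans _ _ (pr [set w | exists2 p, p \in s & A p w])).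
  by apply: le_pr => //; [exact: measurable_has|exact: subset_bad].
apply: le_trans (pr_le_has _ _ mA) _.
apply: (@le_trans _ _ (\sum_(p <- s) (q n * q n + eps n))).
  rewrite big_seq [leRHS]big_seq; apply: ler_sum => -[z z'] /allpairsP[[u v] /=].
  move=> [zn z'n [? ?]]; subst u v; rewrite AE /=.
  have q_ge0 : 0 <= q n by rewrite invr_ge0 !mulr_ge0 ?exprn_ge0.
  case: eqVneq => zz'.
    by rewrite pr_set0 addr_ge0 ?mulr_ge0 // invr_ge0 !mulr_ge0 ?exprn_ge0.
  apply: le_trans (pr_leU _ (measurableI _ _ (mB _ _) (mB _ _)) (mU _ _)) _.
  rewrite lerD ?pr_unlinked_clusters //.
  apply: (@le_trans _ _ (pr (bad n (x + z)) * q n)); last exact: ler_wpM2r.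
  apply: (@pr_le_indep _ _ _ _ _ _ (@mult_indep _ _ _ _ X)
    (edges_in (cball k n (x + z))) (edges_in (cball k n (x + z')))) => //.
  - exact/edges_in_disjoint/cball_shift_disjoint.
  - exact: depends_bad.
  - exact: depends_bad.
rewrite big_const_seq count_predT iter_addr_0 size_allpairs.
rewrite -[size _]/(#|` shifts b k n|) card_shifts // -mulr_natr natrM -/N.
rewrite /q /eps [2 ^+ n.+1]exprS; have := N_gt0; set M := N%:R => M0.
have p1 : 1 <= 2 ^+ n :> R by rewrite exprn_ege1 // ler1n.
set P2 := 2 ^+ n in p1 *.
have P0 : 0 < P2 by apply: lt_le_trans p1.
rewrite -subr_ge0.
rewrite [leRHS](_ : _ = (P2 - 1) / (16 * M ^+ 2 * P2 ^+ 2)).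
  by rewrite divr_ge0 ?subr_ge0 // !mulr_ge0 ?exprn_ge0 // ltW.
by field; rewrite !gt_eqF.
Qed.

Lemma infinite_of_good w : (forall n, ~ bad n 0 w) ->
  infinite_component_event X w.
Proof.
move=> good; have nz n : F n 0 w != fset0 by apply/eqP; exact: good.
have in0 n := cluster0_in n nz.
exists 0; move=> fC.
pose M := #|` fset_set (component w (0 : dsum b))|%fset.
have sub n : (F n 0 w `<=` fset_set (component w (0 : dsum b)))%fset.
  apply/fsubsetP => h hn; rewrite in_fset_set // inE.
  by have [p pp pl] := cluster_connected (in0 n) hn; exists p.
have := fsubset_leq_card (sub M.+1).
apply/negP; rewrite -ltnNge; apply: leq_trans (card_cluster_ge b_ge2 k_gt0 (nz _)).
(* Otherwise [growth] would give [2 <= 2 * alpha ^ k <= 1]. Hence the cluster sizes are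
   unbounded. *)
have N3 : (2 <= N - 1)%N.
  rewrite leqNgt; apply/negP => N1.
  have a1 : 1 <= alpha ^+ k.
    by rewrite exprn_ege1 // (le_trans _ (ltW b_lt_alpha)) // ler1n (ltnW b_ge2).
  have : ((N - 1) ^ 2)%:R <= 1 :> R.
    by rewrite (ler_nat R _ 1) (leq_exp2r (e := 2) _ 1).
  by have := growth; lra.
apply: (@leq_trans (2 ^ M.+1)); first exact: ltn_trans (ltnSn _) (ltn_expl _ _).
by rewrite leq_exp2r.
Qed.

Lemma infinite_component_pos :
  perc_prob X (infinite_component_event X) <> 0%E.
Proof.
pose H M := [set w | exists2 n, n \in iota 0 M & bad n 0 w].
have mB n : measurable (bad n 0) by exact: measurable_bad.
have mH M : measurable (H M) by exact: measurable_has.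
have ndH : nondecreasing_seq H.
  move=> M M' MM'; apply/subsetPset => w [n nM nb]; exists n => //.
  by move: nM; rewrite !mem_iota; lia.
have qn n : q n = q 0%N * 2^-1 ^+ n.
  by rewrite /q expr0 mulr1 invfM exprVn.
have q0 : q 0%N <= 4^-1.
  rewrite /q expr0 mulr1 lef_pV2 ?posrE ?mulr_gt0 ?exprn_gt0 //.
  by rewrite ler_peMr // exprn_ege1 // ler1n -ltnS; move: N_gt0; rewrite ltr0n.
have HM M : pr (H M) <= 2^-1.
  apply: le_trans (pr_le_has _ _ mB) _.
  (* The partial sum of the geometric series of ratio 1/2 and first term 1/4, a bound for [q 0]. *)
  apply: (@le_trans _ _ (2^-1 - 2^-1 * 2^-1 ^+ M)); last first.
    by rewrite gerBl mulr_ge0 ?exprn_ge0 ?invr_ge0.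
  elim: M => [|M IHM]; first by rewrite big_nil expr0 mulr1 subrr.
  rewrite -addn1 iotaD add0n big_cat /= big_seq1 addn1 exprS.
  have pq := pr_bad_le M 0; rewrite qn in pq.
  have p0 : 0 <= 2^-1 ^+ M :> R by rewrite exprn_ge0 ?invr_ge0.
  have := ler_wpM2r p0 q0; lra.
have U12 := pr_bigcup_nondecreasing mH ndH HM.
have mU : measurable (\bigcup_M H M) by exact: bigcupT_measurable.
have mI := measurable_infinite_component X.
have : pr (~` \bigcup_M H M) <= pr (infinite_component_event X).
  apply: le_pr => //; first exact: measurableC.
  move=> w nH; apply: infinite_of_good => n nb; apply: nH.
  by exists n.+1 => //; exists n; rewrite // mem_iota; lia.
rewrite prC // => le P0.
have pI : pr (infinite_component_event X) = 0 by exact: (congr1 fine P0).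
by lra.
Qed.

End Supercritical.


(** * Choice of the block size and conclusion *)

Lemma exists_block_size (R : realType) (b : nat) (alpha : R) : (2 <= b)%N ->
  b%:R < alpha -> alpha < b%:R ^+ 2 ->
  exists2 k, (0 < k)%N & 2 * alpha ^+ k <= ((b ^ k - 1) ^ 2)%:R.
Proof.
move=> b_ge2 b_lt_alpha alpha_lt.
have a0 := alpha_gt0 b_ge2 b_lt_alpha.
have b0 : 0 < b%:R :> R by exact: b_gt0.
have rho1 : `|alpha / b%:R ^+ 2| < 1.
  by rewrite ger0_norm ?divr_ge0 ?exprn_ge0 ?ltW // ltr_pdivrMr ?exprn_gt0 // mul1r.
(* With [N = b ^ k >= 2] one has [(N - 1) ^ 2 >= N ^ 2 / 4], so [alpha ^ k < N ^ 2 / 8] suffices. *)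
have [//|K _ HK] := cvgr_lt (0 : R) (cvg_expr rho1) (8^-1).
exists K.+1 => //; have := HK K.+1 (leqnSn K).
rewrite expr_div_n ltr_pdivrMr ?exprn_gt0 // -exprM mulnC exprM.
have N2 : (2 <= b ^ K.+1)%N.
  by rewrite (leq_trans b_ge2) // -{1}(expn1 b) leq_pexp2l // (ltnW b_ge2).
rewrite natrX natrB ?(ltnW N2) //.
have : 2 <= (b ^ K.+1)%:R :> R by rewrite ler_nat.
rewrite natrX; set M := b%:R ^+ K.+1; nra.
Qed.

Theorem theorem4p1 (R : realType) (b : nat) (hb : (2 <= b)%N) (alpha : R)
    (halpha : b%:R < alpha)
    (X : forall lam : {posnum R},
       percolation (mu_pow (b := b) alpha) lam%:num) :
  (alpha < b%:R ^+ 2 -> (lambda_c X < +oo)%E) /\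
  (b%:R ^+ 2 <= alpha -> lambda_c X = +oo%E).
Proof.
split=> [alpha_lt|alpha_ge].
  have [k k_gt0 growth] := exists_block_size hb halpha alpha_lt.
  pose L := 16 * (b ^ k)%N%:R ^+ 4 * alpha ^+ k.
  apply: (@le_lt_trans _ _ L%:E); last exact: ltry.
  (* The added point 0 is below [L], and a [lam] above [L] would percolate with positive
     probability. *)
  apply: ge_ereal_sup => _ [->|[lam /= P0 <-]]; rewrite lee_fin.
    by rewrite !mulr_ge0 ?exprn_ge0 // ltW // (alpha_gt0 hb halpha).
  rewrite leNgt; apply/negP => /ltW L_le.
  exact: (infinite_component_pos hb k_gt0 halpha growth L_le P0).
(* Every positive real belongs to the set whose supremum is taken. *)
apply/eqyP => A A_gt0; apply: ereal_sup_ubound; right.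
exists (PosNum A_gt0) => //=; exact: no_infinite_component.
Qed.
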